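(* Fix $\rho\in(0,1)$. For each $n\ge 2$ let $X=(X_1,\dots,X_n)'$ be jointly normal with $E[X_i]=0$, $E[X_i^2]=1$ and $\operatorname{Corr}(X_i,X_j)=\rho$ for all $i\neq j$. Let $s_n^2$ be the sample variance of $X$ and $\widehat\rho=(1-s_n^2)\,I(s_n^2<1)$. Then for every sequence of positive reals $(a_n)$ with $a_n=o(n)$, $$\sqrt{a_n}\left(\sqrt{1-\rho}-\sqrt{1-\widehat\rho}\right)\xrightarrow[n\to\infty]{P}0.$$ In particular (taking $a_n=2\ln n$), $\widehat\rho$ satisfies $\sqrt{2\ln n}\,\big(\sqrt{1-\rho}-\sqrt{1-\widehat\rho}\big)\xrightarrow{P}0$.
   Context: The sample variance is $s_n^2=\frac{1}{n-1}X'\left(I_n-\frac1n J_n\right)X$, where $I_n$ is the $n\times n$ identity matrix and $J_n$ the $n\times n$ matrix of ones. $I(\cdot)$ denotes the indicator function. The correlation $\rho$ does not depend on $n$. *)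

(* Defs.v *)
From HB Require Import structures.
From mathcomp Require Import all_boot all_order all_algebra.
From mathcomp Require Import all_classical all_reals all_analysis.
Set Implicit Arguments. Unset Strict Implicit. Unset Printing Implicit Defensive.
Import Order.TTheory GRing.Theory Num.Theory.
Import numFieldNormedType.Exports.
Local Open Scope classical_set_scope.
Local Open Scope ring_scope.

Definition lincomb {T : Type} {R : realType} (n : nat)
  (X : 'I_n -> T -> R) (t : 'I_n -> R) : T -> R :=
  fun w => \sum_(i < n) t i * X i w.

Definition quadform {R : realType} (n : nat) (S : 'M[R]_n) (t : 'I_n -> R) : R :=
  \sum_(i < n) \sum_(j < n) t i * S i j * t j.

(* X = (X_1,...,X_n) is jointly normal with mean 0 and covariance matrix S:
   every linear combination t'X is N(0, t'S t) (a point mass at 0 when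
   t'S t = 0).  (Cramer-Wold definition of a Gaussian vector.) *)
Definition centered_gaussian_vector {d : measure_display} {T : measurableType d}
  {R : realType} (P : probability T R) (n : nat)
  (X : 'I_n -> {RV P >-> R}) (S : 'M[R]_n) : Prop :=
  forall t : 'I_n -> R,
    if 0 < quadform S t then
      forall B : set R, measurable B ->
        P (lincomb (fun i => (X i : T -> R)) t @^-1` B)
        = normal_prob 0 (Num.sqrt (quadform S t)) B
    else P [set w | lincomb (fun i => (X i : T -> R)) t w != 0] = 0%E.

Definition equicorr {R : realType} (n : nat) (rho : R) : 'M[R]_n :=
  \matrix_(i < n, j < n) (if i == j then 1 else rho).

Definition sample_var {R : realType} (n : nat) (x : 'cV[R]_n) : R :=
  (n.-1%:R)^-1 *
  (x^T *m (1%:M - (n%:R)^-1 *: const_mx 1) *m x) ord0 ord0.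

Definition rho_hat {R : realType} (s2 : R) : R := if s2 < 1 then 1 - s2 else 0.

(* Main.v *)
(** The second and fourth moments of a centered Gaussian vector [X] determine,
by polarization, its mixed moments of order four (Isserlis), whence
[E (X'AX) = tr (A S)] and [V (X'AX) = 2 tr ((A S)^2)] for covariance [S] and
symmetric [A]. For the equicorrelation matrix [S] and the centering matrix
[H = I - J / n] one has [H S = (1 - rho) H] with [H] idempotent of trace
[n - 1], so [s2] has mean [1 - rho] and variance [2 (1 - rho)^2 / (n - 1)].
Since [|sqrt (1 - rho) - sqrt (min s2 1)| <= |s2 - (1 - rho)| / sqrt (1 - rho)],
Chebyshev bounds the probability by a constant times [a_n / n]. *)

Require Import Defs.
From mathcomp Require Import all_boot all_order all_algebra.
From mathcomp Require Import all_classical all_reals all_analysis.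
From mathcomp Require Import measurable_realfun ring lra.
Import Order.TTheory GRing.Theory Num.Theory.
Import numFieldNormedType.Exports.
Local Open Scope classical_set_scope.
Local Open Scope ring_scope.

Set Implicit Arguments.
Unset Strict Implicit.
Unset Printing Implicit Defensive.

Lemma cvg_expr_expRN (R : realType) n :
  (x ^+ n * expR (- x) : R) @[x --> +oo] --> (0 : R).
Proof.
apply: (@squeeze_cvgr _ _ _ _ (cst 0) (fun x : R => n.+1`!%:R * x^-1)).
- near=> x; have x_gt0 : 0 < x by near: x; exact: nbhs_pinfty_gt.
  rewrite /= mulr_ge0 ?expR_ge0 ?exprn_ge0 ?(ltW x_gt0)//= expRN.
  rewrite ler_pdivlMr// mulrAC -exprSr ler_pdivrMr ?expR_gt0//.
  rewrite mulrC -ler_pdivrMr ?ltr0n ?fact_gt0//.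
  by apply: le_trans (expR_ge1Dxn n (ltW x_gt0)); rewrite lerDr.
- exact: cvg_cst.
- rewrite -[X in _ --> X](mulr0 n.+1`!%:R); apply: cvgM; first exact: cvg_cst.
  by apply/gtr0_cvgV0; [exact: nbhs_pinfty_gt|exact: cvg_id].
Unshelve. all: end_near. Qed.

Lemma is_derive_normal_pdf (R : realType) (m s x : R) : s != 0 ->
  is_derive x 1 (normal_pdf m s) (- ((x - m) / s ^+ 2) * normal_pdf m s x).
Proof.
move=> s_neq0; rewrite [normal_pdf m s](_ : _ = fun y =>
  normal_peak s * expR (- (y - m) ^+ 2 / (s ^+ 2 *+ 2))) ?normal_pdfE//.
by apply: is_derive_eq; rewrite /GRing.scale/=; field.
Qed.

(* [(2 k - 1)!!] *)
Definition odd_dfact (k : nat) : nat := \prod_(i < k) i.*2.+1.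

Section normal_moments.
Context {R : realType}.
Variable s : R.
Hypothesis s_neq0 : s != 0.
Local Notation mu := (@lebesgue_measure R).
Local Notation p := (normal_pdf 0 s).
Implicit Types (a b x : R) (k : nat).

Lemma centered_normal_pdfE x :
  p x = normal_peak s * expR (- (x ^+ 2 / (s ^+ 2 *+ 2))).
Proof. by rewrite normal_pdfE// /normal_fun subr0 mulNr. Qed.

Lemma continuous_expr_normal_pdf k :
  continuous (fun x => x ^+ k * normal_pdf 0 s x).
Proof.
move=> x; apply: cvgM; first exact: exprn_continuous.
exact: continuous_normal_pdf.
Qed.

Lemma measurable_expr_normal_pdf k :
  measurable_fun [set: R] (fun x => x ^+ k * normal_pdf 0 s x).
Proof. by apply: measurable_funM => //; exact: measurable_normal_pdf. Qed.

Lemma cvg_expr_normal_pdf k :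
  (x ^+ k * normal_pdf 0 s x) @[x --> +oo] --> (0 : R).
Proof.
pose v := s ^+ 2 *+ 2.
have v_gt0 : 0 < v by rewrite pmulrn_lgt0// exprn_even_gt0.
pose y x := x ^+ 2 / v.
apply: (@squeeze_cvgr _ _ _ _ (cst 0)
    (fun x => normal_peak s * v ^+ k * (y x ^+ k * expR (- y x)))).
- near=> x; have x_ge1 : 1 <= x by near: x; exact: nbhs_pinfty_ge.
  have x_ge0 : 0 <= x by exact: le_trans x_ge1.
  rewrite /= mulr_ge0 ?exprn_ge0 ?normal_pdf_ge0//=.
  apply: (@le_trans _ _ ((x ^+ 2) ^+ k * p x)).
    rewrite ler_wpM2r ?normal_pdf_ge0// lerXn2r ?nnegrE ?exprn_ge0//.
    exact: ler_eXnr.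
  rewrite centered_normal_pdfE -/v -/(y x).
  have -> : x ^+ 2 = v * y x by rewrite mulrC divfK// gt_eqF.
  by rewrite exprMn mulrACA [v ^+ k * _]mulrC.
- exact: cvg_cst.
- rewrite -[X in _ --> X](mulr0 (normal_peak s * v ^+ k)).
  apply: cvgM; first exact: cvg_cst.
  apply: (@cvg_comp _ _ _ y (fun z : R => z ^+ k * expR (- z))); last first.
    exact: cvg_expr_expRN.
  apply: gt0_cvgMly; first by rewrite invr_gt0.
  exact: cvgr_expr2.
Unshelve. all: end_near. Qed.

Lemma integral_exprSS_normal_pdf k a b : a < b ->
  (\int[mu]_(x in `[a, b]) (x ^+ k.+2 * p x)%:E =
   (s ^+ 2 * (a ^+ k.+1 * p a - b ^+ k.+1 * p b))%:E +
   (k.+1%:R * s ^+ 2)%:E * \int[mu]_(x in `[a, b]) (x ^+ k * p x)%:E)%E.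
Proof.
move=> ab.
have cp : continuous p by exact: continuous_normal_pdf.
transitivity (\int[mu]_(x in `[a, b]) (x ^+ k.+1 * (x * p x))%:E)%E.
  by apply: eq_integral => x _; rewrite exprSr mulrA.
rewrite (@integration_by_parts R (fun x => x ^+ k.+1) (fun x => - s ^+ 2 * p x)
  (fun x => k.+1%:R * x ^+ k) (fun x => x * p x))//.
- congr (_ + _)%E; first by congr _%:E; ring.
  transitivity (- \int[mu]_(x in `[a, b])
      ((- (k.+1%:R * s ^+ 2))%:E * (x ^+ k * p x)%:E))%E.
    congr (- _)%E; apply: eq_integral => x _; rewrite -EFinM.
    by congr _%:E; ring.
  rewrite integralZl//; first by rewrite EFinN mulNe oppeK.
  apply: continuous_compact_integrable; first exact: segment_compact.
  exact/continuous_subspaceT/continuous_expr_normal_pdf.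
- apply: continuous_subspaceT => x; apply: cvgM; first exact: cvg_cst.
  exact: exprn_continuous.
- split=> [x _||]; first exact: exprn_derivable.
  + by apply: cvg_at_right_filter; exact: exprn_continuous.
  + by apply: cvg_at_left_filter; exact: exprn_continuous.
- by move=> x _; rewrite derive1E exp_derive scaler1.
- exact/continuous_subspaceT/(@continuous_expr_normal_pdf 1).
- split=> [x _||].
  + by have dpx := is_derive_normal_pdf 0 x s_neq0; exact: ex_derive.
  + by apply: cvg_at_right_filter; apply: cvgM; [exact: cvg_cst|exact: cp].
  + by apply: cvg_at_left_filter; apply: cvgM; [exact: cvg_cst|exact: cp].
- move=> x _; have dpx := is_derive_normal_pdf 0 x s_neq0.
  by rewrite derive1E derive_val /GRing.scale/=; field.
Qed.

Lemma integral0y_exprSS_normal_pdf k : ~~ odd k ->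
  (\int[mu]_(x in `[0%R, +oo[) (x ^+ k.+2 * p x)%:E =
   (k.+1%:R * s ^+ 2)%:E * \int[mu]_(x in `[0%R, +oo[) (x ^+ k * p x)%:E)%E.
Proof.
move=> k_even.
have cvg_truncated j : ~~ odd j ->
    (\int[mu]_(x in `[0%R, n%:R]) (x ^+ j * p x)%:E @[n --> \oo] -->
     \int[mu]_(x in `[0%R, +oo[) (x ^+ j * p x)%:E)%E.
  move=> j_even; apply: ge0_cvgn_integral; last first.
    exact: measurable_expr_normal_pdf.
  by move=> x; rewrite mulr_ge0 ?exprn_even_ge0 ?normal_pdf_ge0.
apply: (cvg_unique _ (cvg_truncated k.+2 _)) => //=; first by rewrite negbK.
rewrite -[X in _ --> X]add0e.
have : ((s ^+ 2 * (0 ^+ k.+1 * p 0 - n%:R ^+ k.+1 * p n%:R))%:E +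
    (k.+1%:R * s ^+ 2)%:E * \int[mu]_(x in `[0%R, n%:R]) (x ^+ k * p x)%:E
    @[n --> \oo] -->
  0 + (k.+1%:R * s ^+ 2)%:E * \int[mu]_(x in `[0%R, +oo[) (x ^+ k * p x)%:E)%E.
  apply: cvgeD => //; last exact/cvgeZl/cvg_truncated.
  apply: cvg_EFin; first exact: nearW.
  rewrite -[X in _ --> X](mulr0 (s ^+ 2)); apply: cvgM; first exact: cvg_cst.
  rewrite -[X in _ --> X](subr0 0); apply: cvgB; last first.
    exact: cvg_comp cvgr_idn (@cvg_expr_normal_pdf k.+1).
  by rewrite expr0n/= mul0r; exact: cvg_cst.
apply: cvg_trans; apply: near_eq_cvg; near=> n.
rewrite -integral_exprSS_normal_pdf// ltr0n.
by near: n; exact: nbhs_infty_gt.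
Unshelve. all: end_near. Qed.

Lemma integralT_even_expr_normal_pdf k : ~~ odd k ->
  (\int[mu]_x (x ^+ k * p x)%:E =
   2%:E * \int[mu]_(x in `[0%R, +oo[) (x ^+ k * p x)%:E)%E.
Proof.
move=> k_even; rewrite ge0_symfun_integralT ?set_itvcy//.
- by move=> x; rewrite mulr_ge0 ?exprn_even_ge0 ?normal_pdf_ge0.
- exact: continuous_expr_normal_pdf.
- move=> x /=; rewrite exprNn -signr_odd (negbTE k_even) mul1r.
  by rewrite !centered_normal_pdfE sqrrN.
Qed.

Lemma integral_even_expr_normal_pdf k :
  (\int[mu]_x (x ^+ k.*2 * p x)%:E =
   ((odd_dfact k)%:R * (s ^+ 2) ^+ k)%:E)%E.
Proof.
elim: k => [|k IHk].
  under eq_integral do rewrite expr0 mul1r.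
  by rewrite /odd_dfact big_ord0 expr0 mul1r integral_normal_pdf.
have k2_even : ~~ odd k.*2 by rewrite odd_double.
rewrite doubleS integralT_even_expr_normal_pdf ?(negbK, odd_double)//=.
rewrite integral0y_exprSS_normal_pdf// muleCA.
rewrite -integralT_even_expr_normal_pdf// IHk -EFinM.
rewrite /odd_dfact big_ord_recr/= natrM [in RHS]exprS.
by rewrite mulrACA (mulrC k.*2.+1%:R).
Qed.

End normal_moments.

Lemma ge0_integral_normal_prob (R : realType) (m s : R) (f : R -> \bar R) :
  (forall x, 0 <= f x)%E -> measurable_fun [set: R] f ->
  (\int[normal_prob m s]_x f x =
   \int[lebesgue_measure]_x (f x * (normal_pdf m s x)%:E))%E.
Proof.
move=> f0 mf; have dom := normal_prob_dominates m s.
have mpdf : measurable_fun [set: R] (fun x => (normal_pdf m s x)%:E).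
  by apply/measurable_EFinP; exact: measurable_normal_pdf.
have iRN := Radon_Nikodym_SigmaFinite.f_integrable dom.
have mRN := measurable_int _ iRN.
rewrite -(Radon_Nikodym_SigmaFinite.change_of_variables dom)//.
apply: ge0_ae_eq_integral => //.
- exact: emeasurable_funM.
- exact: emeasurable_funM.
- by move=> x _; rewrite mule_ge0// Radon_Nikodym_SigmaFinite.f_ge0.
- by move=> x _; rewrite mule_ge0// lee_fin normal_pdf_ge0.
- apply: ae_eqe_mul2l; apply: integral_ae_eq => // E _ mE.
  by rewrite -Radon_Nikodym_SigmaFinite.f_integral.
Qed.

Lemma normal_prob_even_moment (R : realType) (s : R) k : s != 0 ->
  (\int[normal_prob 0 s]_x (x ^+ k.*2)%:E =
   ((odd_dfact k)%:R * (s ^+ 2) ^+ k)%:E)%E.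
Proof.
move=> s_neq0; rewrite -integral_even_expr_normal_pdf//.
rewrite ge0_integral_normal_prob//.
- by move=> x; rewrite lee_fin exprn_even_ge0//= odd_double.
- exact/measurable_EFinP/measurable_funX.
Qed.

Section has_expectation.
Context {d : measure_display} {T : measurableType d} {R : realType}.
Variable P : probability T R.
Implicit Types (f g : T -> R) (m n k : R).

Definition has_expectation f m : Prop := f \in Lfun P 1 /\ 'E_P[f]%E = m%:E.

Lemma eq_has_expectation f g m n :
  f =1 g -> m = n -> has_expectation f m -> has_expectation g n.
Proof. by move=> /funext -> ->. Qed.

Lemma ge0_has_expectation f m : measurable_fun [set: T] f ->
  (forall w, 0 <= f w) -> (\int[P]_w (f w)%:E = m%:E)%E -> has_expectation f m.
Proof.
move=> mf f0 fm; split; last by rewrite unlock.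
apply/Lfun1_integrable/integrableP; split; first exact/measurable_EFinP.
under eq_integral do rewrite /= ger0_norm//.
by rewrite fm ltry.
Qed.

Lemma has_expectationD f g m n : has_expectation f m -> has_expectation g n ->
  has_expectation (fun w => f w + g w) (m + n).
Proof.
move=> [lf fm] [lg gn]; split; first exact: (rpredD lf lg).
by rewrite (expectationD lf lg) fm gn.
Qed.

Lemma has_expectationZ k f m :
  has_expectation f m -> has_expectation (fun w => k * f w) (k * m).
Proof.
move=> [lf fm]; have : has_expectation (k \o* f) (k * m).
  by split; [exact: Lfun_scale|rewrite expectationZl// fm].
by apply: eq_has_expectation => // w; rewrite mulrC.
Qed.

Lemma has_expectation_sum (I : Type) (r : seq I) (F : I -> T -> R)
    (m : I -> R) :
  (forall i, has_expectation (F i) (m i)) ->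
  has_expectation (fun w => \sum_(i <- r) F i w) (\sum_(i <- r) m i).
Proof.
move=> Fm; elim: r => [|i r IHr].
  have : has_expectation (cst 0) 0.
    by split; [exact: Lfun_cst|exact: expectation_cst].
  by apply: eq_has_expectation => [w|]; rewrite big_nil.
apply: eq_has_expectation (has_expectationD (Fm i) IHr) => [w|];
  by rewrite big_cons.
Qed.

Lemma has_expectation_variance f m q : has_expectation f m ->
  has_expectation (fun w => f w ^+ 2) q -> ('V_P[f] = (q - m ^+ 2)%:E)%E.
Proof.
move=> [lf fm] [lf2 f2q]; rewrite /variance covarianceE// fm.
by rewrite (_ : (f * f)%R = fun w => f w ^+ 2)// f2q EFinB EFinM.
Qed.

Lemma has_expectation_measurable f m :
  has_expectation f m -> measurable_fun [set: T] f.
Proof. by move=> [/sub_Lfun_mfun]; rewrite inE. Qed.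

Lemma has_expectation_chebyshev f m v (e : R) : 0 < e ->
  has_expectation f m -> 'V_P[f]%E = v%:E ->
  (P [set w | (e <= `|f w - m|)%R] <= (v / e ^+ 2)%:E)%E.
Proof.
move=> e_gt0 [lf fm] fv.
have := @chebyshev _ _ _ P (mfun_Sub (sub_Lfun_mfun lf)) e e_gt0.
by rewrite /= fm fv -EFinM mulrC.
Qed.

End has_expectation.

(* [normal_prob 0 0] is the uniform law on [[0, 1]], not a point mass. *)
Definition centered_normal {d : measure_display} {T : measurableType d}
    {R : realType} (P : probability T R) (L : T -> R) (v : R) : Prop :=
  if 0 < v then
    forall B : set R, measurable B ->
      P (L @^-1` B) = normal_prob 0 (Num.sqrt v) B
  else P [set w | L w != 0] = 0%E.

Section centered_normal.
Context {d : measure_display} {T : measurableType d} {R : realType}.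
Variables (P : probability T R) (L : T -> R).
Hypothesis mL : measurable_fun [set: T] L.

Lemma centered_normal0_even_moment k : centered_normal P L 0 ->
  has_expectation P (fun w => L w ^+ k.*2) (0 ^+ k).
Proof.
rewrite /centered_normal ltxx => L_neq0_null.
have L_ae0 : {ae P, forall w, L w = 0}.
  exists [set w | L w != 0]; split=> //; last by move=> w /= /eqP.
  rewrite (_ : [set _ | _] = [set: T] `&` L @^-1` (~` [set 0])).
    by apply: mL => //; exact: measurableC.
  by rewrite setTI; apply/seteqP; split=> w /= /eqP.
have even_ge0 (x : R) : 0 <= x ^+ k.*2 by rewrite exprn_even_ge0//= odd_double.
apply: ge0_has_expectation => //; first exact: measurable_funX.
transitivity (\int[P]_w (cst (0 ^+ k)%:E) w)%E; last first.
  by rewrite integral_cst//= probability_setT mule1.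
apply: ge0_ae_eq_integral => //.
- exact/measurable_EFinP/measurable_funX.
- by move=> w _; rewrite lee_fin.
- by move=> w _; rewrite lee_fin exprn_ge0.
- by apply: filterS L_ae0 => w /= -> _; rewrite -mul2n exprM [0 ^+ 2]expr0n.
Qed.

Lemma centered_normal_even_moment (v : R) k : 0 <= v -> centered_normal P L v ->
  has_expectation P (fun w => L w ^+ k.*2) ((odd_dfact k)%:R * v ^+ k).
Proof.
rewrite le_eqVlt => /predU1P[<-|v_gt0].
  move=> /(@centered_normal0_even_moment k).
  by case: k => [|k]; rewrite /odd_dfact ?big_ord0 ?mul1r// expr0n mulr0.
rewrite /centered_normal v_gt0 => lawL.
have even_ge0 (x : R) : 0 <= x ^+ k.*2 by rewrite exprn_even_ge0//= odd_double.
apply: ge0_has_expectation => //; first exact: measurable_funX.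
have sv_neq0 : Num.sqrt v != 0 by rewrite gt_eqF// sqrtr_gt0.
rewrite -[in RHS](sqr_sqrtr (ltW v_gt0)) -normal_prob_even_moment//.
pose L' := @mfun_Sub _ _ T (measurableTypeR R) L (mem_set mL).
transitivity (\int[distribution P L']_x (x ^+ k.*2)%:E)%E.
  rewrite ge0_integral_distribution//.
  exact/measurable_EFinP/measurable_funX.
by apply: eq_measure_integral => B mB _; exact: lawL.
Qed.

Lemma centered_normal_moment2 (v : R) : 0 <= v -> centered_normal P L v ->
  has_expectation P (fun w => L w ^+ 2) v.
Proof.
move=> v_ge0 /(@centered_normal_even_moment _ 1 v_ge0).
by rewrite /odd_dfact big_ord_recl big_ord0 mul1r.
Qed.

Lemma centered_normal_moment4 (v : R) : 0 <= v -> centered_normal P L v ->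
  has_expectation P (fun w => L w ^+ 4) (3 * v ^+ 2).
Proof.
move=> v_ge0 /(@centered_normal_even_moment _ 2 v_ge0).
by rewrite /odd_dfact !big_ord_recl big_ord0.
Qed.

End centered_normal.

Section bilinear_form.
Context {R : realType} {n : nat}.
Implicit Types (A S : 'M[R]_n) (u v w : 'I_n -> R) (i j : 'I_n).

Lemma sym_mxE S i j : S^T = S -> S i j = S j i.
Proof. by move=> S_sym; rewrite -[in LHS]S_sym mxE. Qed.

Definition bilinform S u v : R := \sum_i \sum_j u i * S i j * v j.

Definition std_basis i : 'I_n -> R := fun j => (j == i)%:R.

Lemma sum_std_basis i u : \sum_j std_basis i j * u j = u i.
Proof.
rewrite (bigD1 i)//= /std_basis eqxx mul1r big1 ?addr0// => j /negbTE ->.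
by rewrite mul0r.
Qed.

Lemma lincomb_std_basis (T : Type) (X : 'I_n -> T -> R) i :
  lincomb X (std_basis i) = X i.
Proof. by apply/funext => x; exact: sum_std_basis. Qed.

Lemma bilinform_std_basis S i j :
  bilinform S (std_basis i) (std_basis j) = S i j.
Proof.
rewrite /bilinform -[RHS](sum_std_basis i (S^~ j)); apply: eq_bigr => k _.
rewrite -[in RHS](sum_std_basis j (S k)) mulr_sumr.
by apply: eq_bigr => l _; rewrite mulrAC mulrA.
Qed.

Lemma lincombD (T : Type) (X : 'I_n -> T -> R) u v x :
  lincomb X (u \+ v) x = lincomb X u x + lincomb X v x.
Proof.
by rewrite /lincomb -big_split/=; apply: eq_bigr => i _; rewrite mulrDl.
Qed.

Lemma lincombB (T : Type) (X : 'I_n -> T -> R) u v x :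
  lincomb X (u \- v) x = lincomb X u x - lincomb X v x.
Proof. by rewrite /lincomb -sumrB; apply: eq_bigr => i _; rewrite mulrBl. Qed.

Lemma bilinformDl S u v w :
  bilinform S (u \+ v) w = bilinform S u w + bilinform S v w.
Proof.
rewrite /bilinform -big_split/=; apply: eq_bigr => i _.
by rewrite -big_split/=; apply: eq_bigr => j _; rewrite !mulrDl.
Qed.

Lemma bilinformBl S u v w :
  bilinform S (u \- v) w = bilinform S u w - bilinform S v w.
Proof.
rewrite /bilinform -sumrB; apply: eq_bigr => i _.
by rewrite -sumrB; apply: eq_bigr => j _; rewrite !mulrBl.
Qed.

Lemma bilinformDr S u v w :
  bilinform S w (u \+ v) = bilinform S w u + bilinform S w v.
Proof.
rewrite /bilinform -big_split/=; apply: eq_bigr => i _.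
by rewrite -big_split/=; apply: eq_bigr => j _; rewrite mulrDr.
Qed.

Lemma bilinformBr S u v w :
  bilinform S w (u \- v) = bilinform S w u - bilinform S w v.
Proof.
rewrite /bilinform -sumrB; apply: eq_bigr => i _.
by rewrite -sumrB; apply: eq_bigr => j _; rewrite mulrBr.
Qed.

Lemma bilinform_sym S u v : S^T = S -> bilinform S u v = bilinform S v u.
Proof.
move=> S_sym; rewrite /bilinform exchange_big; apply: eq_bigr => i _.
by apply: eq_bigr => j _; rewrite (sym_mxE j i)//; ring.
Qed.

Lemma quadformD S u v : S^T = S ->
  quadform S (u \+ v) = quadform S u + quadform S v + 2 * bilinform S u v.
Proof.
move=> S_sym; rewrite -![quadform S _]/(bilinform S _ _).
by rewrite bilinformDl !bilinformDr (bilinform_sym v u)//; ring.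
Qed.

Lemma quadformB S u v : S^T = S ->
  quadform S (u \- v) = quadform S u + quadform S v - 2 * bilinform S u v.
Proof.
move=> S_sym; rewrite -![quadform S _]/(bilinform S _ _).
by rewrite bilinformBl !bilinformBr (bilinform_sym v u)//; ring.
Qed.

Lemma quadform_sum_pairs A u :
  quadform A u = \sum_(p : 'I_n * 'I_n) A p.1 p.2 * (u p.1 * u p.2).
Proof.
rewrite -(pair_bigA _ (fun i j => A i j * (u i * u j)))/=.
by apply: eq_bigr => i _; apply: eq_bigr => j _; ring.
Qed.

Lemma mxtrace_mulmx_pairs A S : S^T = S ->
  \tr (A *m S) = \sum_(p : 'I_n * 'I_n) A p.1 p.2 * S p.1 p.2.
Proof.
move=> S_sym; rewrite -(pair_bigA _ (fun i j => A i j * S i j))/=.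
apply: eq_bigr => i _; rewrite mxE.
by apply: eq_bigr => j _; rewrite (sym_mxE j i).
Qed.

Lemma mxtrace_sqr_mulmx_pairs A S : S^T = S ->
  \tr (A *m S *m (A *m S)) = \sum_(p : 'I_n * 'I_n) \sum_(q : 'I_n * 'I_n)
    A p.1 p.2 * A q.1 q.2 * (S p.1 q.2 * S p.2 q.1).
Proof.
move=> S_sym; rewrite -(pair_bigA _ (fun i a => \sum_(q : 'I_n * 'I_n)
    A i a * A q.1 q.2 * (S i q.2 * S a q.1)))/=.
apply: eq_bigr => i _; rewrite mxE.
under [LHS]eq_bigr do rewrite !mxE mulr_suml.
rewrite exchange_big; apply: eq_bigr => a _.
rewrite -(pair_bigA _ (fun j b => A i a * A j b * (S i b * S a j)))/=.
apply: eq_bigr => j _; rewrite mulr_sumr; apply: eq_bigr => b _.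
by rewrite (sym_mxE b i)// (sym_mxE a j)//; ring.
Qed.

End bilinear_form.

Section gaussian_vector.
Context {d : measure_display} {T : measurableType d} {R : realType}.
Variables (P : probability T R) (n : nat).
Variables (X : 'I_n -> {RV P >-> R}) (S : 'M[R]_n).
Hypothesis S_sym : S^T = S.
Hypothesis S_psd : forall t, 0 <= quadform S t.
Hypothesis gaussX : centered_gaussian_vector X S.
Implicit Types (t u v y z : 'I_n -> R) (A : 'M[R]_n).

Local Notation L := (lincomb (fun i => (X i : T -> R))).
Local Notation B := (bilinform S).
Local Notation Q := (quadform S).

Lemma measurable_lincomb t : measurable_fun [set: T] (L t).
Proof. by apply: measurable_sum => i; exact: measurable_funM. Qed.

Lemma gaussian_lincomb_moment2 t :
  has_expectation P (fun w => L t w ^+ 2) (Q t).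
Proof.
apply: centered_normal_moment2 (S_psd t) (gaussX t).
exact: measurable_lincomb.
Qed.

Lemma gaussian_lincomb_moment4 t :
  has_expectation P (fun w => L t w ^+ 4) (3 * Q t ^+ 2).
Proof.
apply: centered_normal_moment4 (S_psd t) (gaussX t).
exact: measurable_lincomb.
Qed.

Lemma gaussian_lincomb_moment11 u v :
  has_expectation P (fun w => L u w * L v w) (B u v).
Proof.
have := has_expectationD
  (has_expectationZ 4^-1 (gaussian_lincomb_moment2 (u \+ v)))
  (has_expectationZ (- 4^-1) (gaussian_lincomb_moment2 (u \- v))).
apply: eq_has_expectation => [w|]; first by rewrite lincombB lincombD; field.
by rewrite quadformB// quadformD//; field.
Qed.

(* [(a + b)^4 + (a - b)^4 = 2 a^4 + 12 a^2 b^2 + 2 b^4] *)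
Lemma gaussian_lincomb_moment22 u v :
  has_expectation P (fun w => L u w ^+ 2 * L v w ^+ 2)
    (Q u * Q v + 2 * B u v ^+ 2).
Proof.
have := has_expectationZ 12^-1 (has_expectationD
  (has_expectationD (gaussian_lincomb_moment4 (u \+ v))
                    (gaussian_lincomb_moment4 (u \- v)))
  (has_expectationZ (- 2) (has_expectationD (gaussian_lincomb_moment4 u)
                                            (gaussian_lincomb_moment4 v)))).
apply: eq_has_expectation => [w|]; first by rewrite lincombB lincombD; field.
by rewrite quadformB// quadformD//; field.
Qed.

(* [16 a b c e = ((a + b)^2 - (a - b)^2) ((c + e)^2 - (c - e)^2)] *)
Lemma isserlis u v y z :
  has_expectation P (fun w => (L u w * L v w) * (L y w * L z w))
    (B u v * B y z + B u y * B v z + B u z * B v y).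
Proof.
have := has_expectationZ 16^-1 (has_expectationD
  (has_expectationD (gaussian_lincomb_moment22 (u \+ v) (y \+ z))
                    (gaussian_lincomb_moment22 (u \- v) (y \- z)))
  (has_expectationZ (- 1)
    (has_expectationD (gaussian_lincomb_moment22 (u \+ v) (y \- z))
                      (gaussian_lincomb_moment22 (u \- v) (y \+ z))))).
apply: eq_has_expectation => [w|]; first by rewrite !lincombB !lincombD; field.
rewrite !quadformB// !quadformD// !bilinformBl !bilinformDl.
by rewrite !bilinformBr !bilinformDr; field.
Qed.

Lemma gaussian_quadform_expectation A :
  has_expectation P (fun w => quadform A (fun i => X i w)) (\tr (A *m S)).
Proof.
have := has_expectation_sum (index_enum _) (fun p : 'I_n * 'I_n =>
  has_expectationZ (A p.1 p.2)
    (gaussian_lincomb_moment11 (std_basis p.1) (std_basis p.2))).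
apply: eq_has_expectation => [w|].
  by rewrite quadform_sum_pairs; under eq_bigr do rewrite !lincomb_std_basis.
rewrite mxtrace_mulmx_pairs//.
by apply: eq_bigr => p _; rewrite bilinform_std_basis.
Qed.

Lemma gaussian_quadform_moment2 A : A^T = A ->
  has_expectation P (fun w => quadform A (fun i => X i w) ^+ 2)
    (\tr (A *m S) ^+ 2 + 2 * \tr (A *m S *m (A *m S))).
Proof.
move=> A_sym.
have := has_expectation_sum (index_enum _) (fun p : 'I_n * 'I_n =>
  has_expectation_sum (index_enum _) (fun q : 'I_n * 'I_n =>
    has_expectationZ (A p.1 p.2 * A q.1 q.2)
      (isserlis (std_basis p.1) (std_basis p.2)
                (std_basis q.1) (std_basis q.2)))).
apply: eq_has_expectation => [w|].
  rewrite quadform_sum_pairs expr2 [RHS]mulr_suml; apply: eq_bigr => p _.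
  rewrite [RHS]mulr_sumr; apply: eq_bigr => q _.
  by rewrite !lincomb_std_basis mulrACA.
(* Transposing [q] identifies the two crossed pairings. *)
pose swap (q : 'I_n * 'I_n) := (q.2, q.1).
have swapK : involutive swap by case.
rewrite mulr_natl mulr2n {2}mxtrace_sqr_mulmx_pairs//.
rewrite mxtrace_sqr_mulmx_pairs// mxtrace_mulmx_pairs// expr2 mulr_suml.
rewrite -!big_split/=; apply: eq_bigr => p _.
rewrite [X in _ = _ + (X + _)](reindex_inj (inv_inj swapK)) mulr_sumr.
rewrite -!big_split/=; apply: eq_bigr => q _.
by rewrite !bilinform_std_basis (sym_mxE q.2 q.1 A_sym)/=; ring.
Qed.

Lemma gaussian_quadform_variance A : A^T = A ->
  ('V_P[fun w => quadform A (fun i => X i w)] =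
   (2 * \tr (A *m S *m (A *m S)))%:E)%E.
Proof.
move=> A_sym; rewrite (has_expectation_variance
  (gaussian_quadform_expectation A) (gaussian_quadform_moment2 A_sym)).
by congr _%:E; ring.
Qed.

End gaussian_vector.

Section sample_variance.
Context {R : realType} {n : nat}.
Hypothesis n_gt0 : (0 < n)%N.
Implicit Types (rho : R) (t x : 'I_n -> R).

Local Notation J := (const_mx 1 : 'M[R]_n).

Definition centering_mx : 'M[R]_n := 1%:M - n%:R^-1 *: J.

Let n_neq0 : n%:R != 0 :> R. Proof. by rewrite pnatr_eq0 -lt0n. Qed.

Lemma centering_mx_sym : centering_mx^T = centering_mx.
Proof. by rewrite /centering_mx linearB linearZ/= trmx1 trmx_const. Qed.

Lemma mulmx_centering_const1 : centering_mx *m J = 0.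
Proof.
have JJ : J *m J = n%:R *: J.
  apply/matrixP => i j; rewrite !mxE.
  by under eq_bigr do rewrite !mxE mulr1; rewrite sumr_const card_ord mulr1.
by rewrite mulmxBl mul1mx -scalemxAl JJ scalerA mulVf// scale1r subrr.
Qed.

Lemma mulmx_centering_id : centering_mx *m centering_mx = centering_mx.
Proof.
rewrite {2}/centering_mx mulmxBr mulmx1 -scalemxAr.
by rewrite mulmx_centering_const1 scaler0 subr0.
Qed.

Lemma mxtrace_centering : \tr centering_mx = n.-1%:R.
Proof.
rewrite linearB/= mxtrace1 linearZ/= [\tr J](_ : _ = n%:R) ?mulVf//.
  by rewrite -[in LHS](prednK n_gt0) -natr1 addrK.
by rewrite /mxtrace; under eq_bigr do rewrite mxE; rewrite sumr_const card_ord.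
Qed.

Lemma equicorrE rho : equicorr n rho = (1 - rho)%:M + rho *: J.
Proof.
apply/matrixP => i j; rewrite !mxE mulr1.
by case: eqP => _; rewrite ?subrK ?add0r.
Qed.

Lemma equicorr_sym rho : (equicorr n rho)^T = equicorr n rho.
Proof. by rewrite equicorrE linearD linearZ/= tr_scalar_mx trmx_const. Qed.

Lemma quadform_equicorr rho t : quadform (equicorr n rho) t =
  (1 - rho) * (\sum_i t i ^+ 2) + rho * (\sum_i t i) ^+ 2.
Proof.
rewrite expr2 mulr_suml !mulr_sumr -big_split/=; apply: eq_bigr => i _.
rewrite (bigD1 i)//= [in RHS](bigD1 i)//= mxE eqxx.
transitivity (t i ^+ 2 + \sum_(j < n | j != i) rho * t i * t j).
  congr (_ + _); first by ring.
  by apply: eq_bigr => j /negbTE ji; rewrite mxE eq_sym ji; ring.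
by rewrite -mulr_sumr; ring.
Qed.

Lemma quadform_equicorr_ge0 rho t : 0 <= rho <= 1 ->
  0 <= quadform (equicorr n rho) t.
Proof.
move=> /andP[rho_ge0 rho_le1]; rewrite quadform_equicorr.
apply: addr_ge0; apply: mulr_ge0; rewrite ?subr_ge0 ?sqr_ge0//.
by apply: sumr_ge0 => i _; exact: sqr_ge0.
Qed.

Lemma mulmx_centering_equicorr rho :
  centering_mx *m equicorr n rho = (1 - rho) *: centering_mx.
Proof.
rewrite equicorrE mulmxDr mul_mx_scalar -scalemxAr.
by rewrite mulmx_centering_const1 scaler0 addr0.
Qed.

Lemma sample_varE x :
  sample_var (\col_i x i) = quadform (n.-1%:R^-1 *: centering_mx) x.
Proof.
rewrite /sample_var /quadform -mulmxA mxE mulr_sumr; apply: eq_bigr => i _.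
rewrite !mxE !mulr_sumr; apply: eq_bigr => j _.
by rewrite !mxE; ring.
Qed.

End sample_variance.

Lemma rho_hatE (R : realType) (x : R) : rho_hat x = 1 - Num.min x 1.
Proof. by rewrite /rho_hat minEle; case: (ltgtP x 1) => [_|_|->]; ring. Qed.

Lemma measurable_rho_hat (R : realType) : measurable_fun [set: R] (@rho_hat R).
Proof.
rewrite (funext (@rho_hatE R)); apply: measurable_funB => //.
exact: measurable_minr.
Qed.

Lemma sqrt_dist_le (R : rcfType) (x y : R) : 0 <= x ->
  `|Num.sqrt x - Num.sqrt y| * Num.sqrt x <= `|x - y|.
Proof.
move=> x_ge0; have [y_ge0|y_lt0] := leP 0 y; last first.
  rewrite (ltr0_sqrtr y_lt0) subr0 ger0_norm ?sqrtr_ge0// -expr2 sqr_sqrtr//.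
  by rewrite ger0_norm; lra.
rewrite -[in leRHS](sqr_sqrtr x_ge0) -[in leRHS](sqr_sqrtr y_ge0).
rewrite subr_sqr normrM.
by rewrite ler_wpM2l// ger0_norm ?addr_ge0 ?sqrtr_ge0// lerDl sqrtr_ge0.
Qed.

Lemma sqrt_rho_hat_dist_le (R : realType) (x y : R) : 0 <= x <= 1 ->
  `|Num.sqrt x - Num.sqrt (1 - rho_hat y)| * Num.sqrt x <= `|y - x|.
Proof.
move=> /andP[x_ge0 x_le1]; apply: le_trans (sqrt_dist_le _ x_ge0) _.
rewrite rho_hatE subKr distrC minEle; case: (leP y 1) => // y_gt1.
by rewrite !ger0_norm; lra.
Qed.

Section equicorrelated_sample.
Context {d : measure_display} {T : measurableType d} {R : realType}.
Variables (P : probability T R) (n : nat) (X : 'I_n -> {RV P >-> R}) (rho : R).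
Hypothesis n_gt1 : (1 < n)%N.
Hypothesis rho01 : 0 <= rho <= 1.
Hypothesis gaussX : centered_gaussian_vector X (equicorr n rho).

Local Notation s2 w := (sample_var (\col_i (X i : T -> R) w)).
Local Notation sqrt_error w :=
  (Num.sqrt (1 - rho) - Num.sqrt (1 - rho_hat (s2 w))).

Let n_gt0 : (0 < n)%N. Proof. exact: ltnW. Qed.

Let n1_gt0 : 0 < n.-1%:R :> R. Proof. by rewrite ltr0n -ltnS prednK. Qed.

Let sample_var_mx : 'M[R]_n := n.-1%:R^-1 *: centering_mx.

Let sample_var_mx_equicorr :
  sample_var_mx *m equicorr n rho = ((1 - rho) / n.-1%:R) *: centering_mx.
Proof.
by rewrite -scalemxAl mulmx_centering_equicorr// scalerA mulrC.
Qed.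

Lemma sample_var_expectation : has_expectation P (fun w => s2 w) (1 - rho).
Proof.
have := gaussian_quadform_expectation (equicorr_sym rho)
  (fun t => quadform_equicorr_ge0 t rho01) gaussX sample_var_mx.
apply: eq_has_expectation => [w|]; first by rewrite sample_varE.
by rewrite sample_var_mx_equicorr linearZ/= mxtrace_centering// divfK// gt_eqF.
Qed.

Lemma sample_var_variance :
  ('V_P[fun w => s2 w] = (2 * (1 - rho) ^+ 2 / n.-1%:R)%:E)%E.
Proof.
under eq_fun do rewrite sample_varE.
rewrite (gaussian_quadform_variance (equicorr_sym rho)
  (fun t => quadform_equicorr_ge0 t rho01) gaussX); last first.
  by rewrite linearZ/= centering_mx_sym.
rewrite sample_var_mx_equicorr -scalemxAl -scalemxAr mulmx_centering_id//.
rewrite scalerA linearZ/= mxtrace_centering//; congr _%:E; field.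
by rewrite gt_eqF.
Qed.

Lemma sqrt_rho_hat_tail (e : R) : rho < 1 -> 0 < e ->
  (P [set w | (e <= `|sqrt_error w|)%R] <=
   (2 * (1 - rho) / (n.-1%:R * e ^+ 2))%:E)%E.
Proof.
move=> rho_lt1 e_gt0; have c_gt0 : 0 < 1 - rho by rewrite subr_gt0.
have ms2 := has_expectation_measurable sample_var_expectation.
have ec_gt0 : 0 < e * Num.sqrt (1 - rho) by rewrite mulr_gt0 ?sqrtr_gt0.
have <- : 2 * (1 - rho) ^+ 2 / n.-1%:R / (e * Num.sqrt (1 - rho)) ^+ 2 =
    2 * (1 - rho) / (n.-1%:R * e ^+ 2).
  by rewrite exprMn sqr_sqrtr ?ltW//; field; rewrite !gt_eqF.
apply: le_trans (has_expectation_chebyshev ec_gt0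
  sample_var_expectation sample_var_variance).
apply: le_measure; rewrite ?inE.
- rewrite -[X in measurable X]setTI; apply: measurable_fun_le => //.
  apply: measurableT_comp => //; apply: measurable_funB => //.
  apply: measurableT_comp.
    exact: continuous_measurable_fun (@sqrt_continuous R).
  apply: measurable_funB => //.
  exact: measurableT_comp (@measurable_rho_hat R) ms2.
- rewrite -[X in measurable X]setTI; apply: measurable_fun_le => //.
  by apply: measurableT_comp => //; exact: measurable_funB.
- move=> w /= e_le; apply: le_trans (sqrt_rho_hat_dist_le _ _).
    by rewrite ler_wpM2r ?sqrtr_ge0.
  by have /andP[rho_ge0 _] := rho01; rewrite ltW// gerBl.
Qed.

Lemma scaled_sqrt_rho_hat_tail (a eps : R) : rho < 1 -> 0 < a -> 0 < eps ->
  (P [set w | (eps <= `|Num.sqrt a * sqrt_error w|)%R] <=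
   (4 * (1 - rho) / eps ^+ 2 * (a / n%:R))%:E)%E.
Proof.
move=> rho_lt1 a_gt0 eps_gt0.
have sa_gt0 : 0 < Num.sqrt a by rewrite sqrtr_gt0.
under eq_set do rewrite normrM (gtr0_norm sa_gt0) -ler_pdivrMl// mulrC.
have := sqrt_rho_hat_tail rho_lt1 (divr_gt0 eps_gt0 sa_gt0).
move=> /le_trans; apply; rewrite lee_fin expr_div_n (sqr_sqrtr (ltW a_gt0)).
have -> : 2 * (1 - rho) / (n.-1%:R * (eps ^+ 2 / a)) =
    4 * (1 - rho) / eps ^+ 2 * (a / (2 * n.-1%:R)).
  by field; rewrite !gt_eqF.
rewrite ler_wpM2l//.
  by rewrite divr_ge0 ?sqr_ge0 ?mulr_ge0 ?subr_ge0 ?(ltW rho_lt1).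
rewrite ler_pM2l// lef_pV2 ?posrE ?mulr_gt0// ?ltr0n// -natrM ler_nat.
by case: (n) n_gt1 => [|[|m]]// _; rewrite mul2n -addnn addSn ltnS leq_addl.
Qed.

End equicorrelated_sample.

Unset Implicit Arguments.
Set Strict Implicit.

Theorem theorem1 (R : realType) (rho : R) (d : measure_display)
  (T : nat -> measurableType d) (P : forall n, probability (T n) R)
  (X : forall n, 'I_n -> {RV (P n) >-> R}) (a : nat -> R) :
  0 < rho < 1 ->
  (forall n, (2 <= n)%N -> centered_gaussian_vector (X n) (equicorr n rho)) ->
  (forall n, 0 < a n) ->
  (fun n => a n / n%:R) @ \oo --> 0 ->
  forall eps : R, 0 < eps ->
    (fun n => P n [set w | eps <=
       `| Num.sqrt (a n) *
          (Num.sqrt (1 - rho)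
           - Num.sqrt (1 - rho_hat (sample_var (\col_i (X n i : T n -> R) w))))|])
    @ \oo --> 0%E.
Proof.
move=> /andP[rho_gt0 rho_lt1] gaussX a_gt0 cvga eps eps_gt0.
pose C := 4 * (1 - rho) / eps ^+ 2.
apply: (@squeeze_cvge _ _ _ _ (cst 0%E) _ (fun n => (C * (a n / n%:R))%:E)).
- near=> n; rewrite measure_ge0/=; apply: scaled_sqrt_rho_hat_tail => //.
  + by near: n; exact: nbhs_infty_gt.
  + by rewrite !ltW.
  + by apply: gaussX; near: n; exact: nbhs_infty_gt.
- exact: cvg_cst.
- apply: cvg_EFin; first exact: nearW.
  by rewrite -[X in _ --> X](mulr0 C); apply: cvgM => //; exact: cvg_cst.
Unshelve. all: end_near. Qed.
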